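(* Let $R>0$ and let $P$, with density $h$, have the peakless sublevel tail property (PSTP) outside $\overline{B}(0,R)$. Then there exists a constant $c_{21}>0$ such that for every compact $K\subset\mathbb{R}^d$ there is $n_K\in\mathbb{N}$ such that for all $n\ge n_K$ and all $x\in K$, $$c_{21}\,n^{-1/d}\,h(x)^{-\frac{1}{r+d}}\ \ge\ d(x,\alpha_n).$$
   Context: $\|\cdot\|$ is an arbitrary fixed norm on $\mathbb{R}^d$, $d\ge1$; $\lambda^d$ is Lebesgue measure; $B(x,s)=\{y:\|y-x\|<s\}$, $\overline{B}(x,s)$ the closed ball; $d(x,A)=\inf_{a\in A}\|x-a\|$. Fix $r\in(0,\infty)$. $P$ is a Borel probability on $\mathbb{R}^d$ with $\int\|x\|^{r+\delta}dP(x)<\infty$ for some $\delta>0$. For each $n\in\mathbb{N}$, $\alpha_n$ is an arbitrary fixed $n$-optimal codebook of order $r$ for $P$: $\operatorname{card}(\alpha_n)\le n$ and $\int d(x,\alpha_n)^r\,dP(x)=\inf\{\int d(x,\alpha)^r\,dP(x):\alpha\subset\mathbb{R}^d,\ 1\le\operatorname{card}(\alpha)\le n\}$. A Borel measurable map $f:\mathbb{R}^d\to\mathbb{R}$ satisfies the peakless sublevel property (PSP) outside $\overline{B}(0,R)$ if there are real constants $s_0,c_f>0$ such that for all $x\in\mathbb{R}^d\setminus\overline{B}(0,R)$ and all $s\in(0,s_0)$: $\lambda^d(\{f\le f(x)\}\cap B(x,s))\ge c_f\,\lambda^d(B(x,s))$. $P$ has the peakless sublevel tail property (PSTP) outside $\overline{B}(0,R)$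 if: (i) $P$ is absolutely continuous with an essentially bounded density $h$; (ii) $h$ is bounded away from $0$ on compact sets, that is, for every $\rho>0$ there is $c_\rho>0$ with $h(x)\ge c_\rho$ for all $x\in\overline{B}(0,\rho)$; (iii) there exist a function $f:\mathbb{R}^d\to I$, $I$ an interval of $\mathbb{R}$, having the PSP outside $\overline{B}(0,R)$, and a nonincreasing function $g:I\to(0,+\infty)$ such that $h(x)=g(f(x))$ for all $x\in\mathbb{R}^d$ with $\|x\|\ge R$.
   Formalization: The density h is additionally assumed bounded at every point of the closed ball of radius R; essential boundedness alone allows h to be unbounded on a dense null sequence there, for which the bound at every x in K fails. *)

(* Defs.v *)
From HB Require Import structures.
From mathcomp Require Import all_boot all_order all_algebra.
From mathcomp Require Import all_classical all_reals all_analysis.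
From mathcomp Require Import measurable_realfun ess_sup_inf.

Set Implicit Arguments.
Unset Strict Implicit.
Unset Printing Implicit Defensive.

Import Order.TTheory GRing.Theory Num.Theory.
Import numFieldNormedType.Exports.

Local Open Scope classical_set_scope.
Local Open Scope ring_scope.

(* The Borel sigma-algebra. The topology is that of the sup norm, which is    *)
(* the topology of every norm on a finite-dimensional space.                  *)
HB.instance Definition _ (R : realType) (m n : nat) := @isMeasurable.Build
  default_measure_display 'M[R]_(m, n) <<s open >>
  (@sigma_algebra0 _ setT open) (@sigma_algebraC _ open)
  (@sigma_algebra_bigcup _ setT open).

Section borel_rV.
Variable R : realType.

Lemma open_measurable_mx m n (U : set 'M[R]_(m, n)) : open U -> measurable U.
Proof. exact: sub_sigma_algebra. Qed.

Lemma measurable_coord m n (i : 'I_m) (j : 'I_n) :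
  measurable_fun setT (fun M : 'M[R]_(m, n) => M i j).
Proof.
apply: (measurability _ (RGenOpens.measurableE R)) => //.
move=> _ [_ [a [b ->] <-]]; rewrite setTI.
apply: open_measurable_mx; apply: open_comp; last exact: interval_open.
by move=> M _; exact: coord_continuous.
Qed.

Lemma measurable_fun_rV dT (T : measurableType dT) n (f : T -> 'rV[R]_n) :
  (forall i, measurable_fun setT (fun x => f x ord0 i)) ->
  measurable_fun setT f.
Proof.
move=> mf.
apply: (@measurability _ _ _ _ _ f (@open 'rV[R]_n)) => //.
move=> _ [U oU <-]; rewrite setTI.
pose B (q : 'rV[rat]_n * nat) : set 'rV[R]_n :=
  [set v | forall i, `|ratr (q.1 ord0 i) - v ord0 i| < q.2.+1%:R^-1].
pose C q := if pselect (B q `<=` U) then f @^-1` B q else set0.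
have -> : f @^-1` U = \bigcup_q C q.
  apply/seteqP; split => [x /= Ux|x [q _ /=]]; last first.
    by rewrite /C; case: pselect => // BU /BU.
  have [e e0 eU] : exists2 e : R, 0 < e & ball (f x) e `<=` U.
    by have /nbhs_ballP[e /= e0 eU] := oU _ Ux; exists e.
  have [k ke] : exists k : nat, k.+1%:R^-1 < e / 2.
    have e2 : 0 < e / 2 by rewrite divr_gt0.
    exists (Num.truncn (e / 2)^-1).
    by rewrite invf_plt ?posrE// truncnS_gt.
  have /choice[q qP] : forall i, exists q : rat,
      `|ratr q - f x ord0 i| < k.+1%:R^-1.
    move=> i; set a := f x ord0 i.
    have [|q] := @rat_in_itvoo R (a - k.+1%:R^-1) (a + k.+1%:R^-1).
      by rewrite ltrD2l gtrN.
    rewrite in_itv/= => /andP[q1 q2]; exists q.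
    by rewrite ltr_distl q1 q2.
  exists (\row_i q i, k) => //; rewrite /C; case: pselect => [BU i|].
    by have := qP i; rewrite /= mxE.
  case=> v /= vB; apply: eU; split=> // i j.
  rewrite /ball/= (ord1 i).
  have := vB j; rewrite mxE => vj.
  have := qP j; rewrite distrC => fj.
  rewrite (le_lt_trans (ler_distD (ratr (q j)) _ _))// (splitr e).
  by rewrite ltrD// (lt_trans _ ke).
apply: countable_bigcupT_measurable => // q.
rewrite /C; case: pselect => /= BU; last exact: measurable0.
have -> : f @^-1` B q = \bigcap_(i in [set: 'I_n])
    ((fun x => f x ord0 i) @^-1`
      `]ratr (q.1 ord0 i) - q.2.+1%:R^-1, ratr (q.1 ord0 i) + q.2.+1%:R^-1[).
  apply/seteqP; split => [x /= xB i _ /=|x /= xB i].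
    by have := xB i; rewrite distrC ltr_distl in_itv.
  by have := xB i Logic.I; rewrite /= in_itv/= distrC ltr_distl.
apply: fin_bigcap_measurable => // i _.
by rewrite -[X in measurable X]setTI; apply: mf.
Qed.

End borel_rV.

(* Lebesgue measure on R^d, as the d-fold product of the Lebesgue measure on  *)
(* R, transported along R * R^d -> R^d.+1.                                    *)
Section lebesgue_rV.
Variable R : realType.

Definition cons_rV d (p : measurableTypeR R * 'rV[R]_d) : 'rV[R]_d.+1 :=
  row_mx (p.1 : R)%:M p.2.

Definition uncons_rV d (v : 'rV[R]_d.+1) : measurableTypeR R * 'rV[R]_d :=
  (v ord0 ord0, \row_i v ord0 (lift ord0 i)).

Lemma cons_rV0 d p : @cons_rV d p ord0 ord0 = p.1.
Proof.
have -> : ord0 = lshift d (ord0 : 'I_1) by exact: val_inj.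
by apply: etrans (row_mxEl _ _ _ _) _; rewrite mxE mulr1n.
Qed.

Lemma cons_rVS d p i : @cons_rV d p ord0 (lift ord0 i) = p.2 ord0 i.
Proof.
have -> : lift ord0 i = rshift 1 i by exact: val_inj.
exact: (row_mxEr (p.1)%:M p.2).
Qed.

Lemma cons_rVK d : cancel (@cons_rV d) (@uncons_rV d).
Proof.
move=> [x v]; rewrite /uncons_rV cons_rV0; congr pair.
by apply/rowP => i; rewrite mxE cons_rVS.
Qed.

Lemma measurable_cons_rV d : measurable_fun setT (@cons_rV d).
Proof.
apply: measurable_fun_rV => i.
have [->|[j ->]] : i = ord0 \/ exists j, i = lift ord0 j.
- by case: (unliftP ord0 i) => [j ->|->]; [right; exists j|left].
- by under eq_fun do rewrite cons_rV0; exact: measurable_fst.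
- under eq_fun do rewrite cons_rVS.
  exact: (measurableT_comp (measurable_coord _ _) measurable_snd).
Qed.

Lemma measurable_uncons_rV d : measurable_fun setT (@uncons_rV d).
Proof.
apply: measurable_fun_pair; first exact: measurable_coord.
apply: measurable_fun_rV => i.
by under eq_fun do rewrite mxE; exact: measurable_coord.
Qed.

Section step.
Variables (d : nat) (mu : {sigma_finite_measure set 'rV[R]_d -> \bar R}).
Local Open Scope ereal_scope.

Definition lebesgue_rVS : set 'rV[R]_d.+1 -> \bar R :=
  pushforward (@lebesgue_measure R \x mu) (@cons_rV d).

Let lebesgue_rVS0 : lebesgue_rVS set0 = 0.
Proof. by apply: measure0; exact: measurable_cons_rV. Qed.

Let lebesgue_rVS_ge0 A : 0 <= lebesgue_rVS A.
Proof. by apply: measure_ge0; exact: measurable_cons_rV. Qed.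

Let lebesgue_rVS_sigma_additive : semi_sigma_additive lebesgue_rVS.
Proof.
by apply: measure_semi_sigma_additive; exact: measurable_cons_rV.
Qed.

HB.instance Definition _ := isMeasure.Build _ _ _ lebesgue_rVS
  lebesgue_rVS0 lebesgue_rVS_ge0 lebesgue_rVS_sigma_additive.

Let sigma_finite_lebesgue_rVS : sigma_finite setT lebesgue_rVS.
Proof.
have /sigma_finiteP[F [FT ndF Foo]] := sigma_finiteT (@lebesgue_measure R).
have /sigma_finiteP[G [GT ndG Goo]] := sigma_finiteT mu.
exists (fun i => @uncons_rV d @^-1` (F i `*` G i)).
  rewrite -preimage_bigcup; apply/seteqP; split => // v _ /=.
  have : [set: measurableTypeR R] (uncons_rV v).1 by [].
  rewrite FT => -[i _ Fi].
  have : [set: 'rV[R]_d] (uncons_rV v).2 by [].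
  rewrite GT => -[j _ Gj].
  exists (maxn i j) => //; split.
  - by apply: (subsetPset _ _ (ndF _ _ (leq_maxl i j))).
  - by apply: (subsetPset _ _ (ndG _ _ (leq_maxr i j))).
move=> i; have [mFi Fioo] := Foo i; have [mGi Gioo] := Goo i.
split.
  rewrite -[X in measurable X]setTI; apply: measurable_uncons_rV => //.
  exact: measurableX.
rewrite /lebesgue_rVS /pushforward -comp_preimage.
rewrite (_ : _ \o _ = id) ?preimage_id; last by apply/funext; exact: cons_rVK.
by rewrite product_measure1E// lte_mul_pinfty// ge0_fin_numE.
Qed.

HB.instance Definition _ :=
  Measure_isSigmaFinite.Build _ _ _ lebesgue_rVS sigma_finite_lebesgue_rVS.

End step.

Fixpoint lebesgue_rV d : {sigma_finite_measure set 'rV[R]_d -> \bar R} :=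
  match d with
  | 0 => \d_(0 : 'rV[R]_0)
  | d'.+1 => lebesgue_rVS (lebesgue_rV d')
  end.

End lebesgue_rV.

Section quantization.
Variables (R : realType) (d : nat).
Implicit Types (N h f : 'rV[R]_d -> R) (P : probability 'rV[R]_d R).

Definition is_norm N :=
  [/\ forall x y, N (x + y) <= N x + N y,
      forall (a : R) x, N (a *: x) = `|a| * N x &
      forall x, N x = 0 -> x = 0].

Definition nball N (x : 'rV[R]_d) (s : R) : set 'rV[R]_d :=
  [set y | N (y - x) < s].

Definition cnball N (x : 'rV[R]_d) (s : R) : set 'rV[R]_d :=
  [set y | N (y - x) <= s].

Definition dist_set N (x : 'rV[R]_d) (A : set 'rV[R]_d) : R :=
  inf [set N (x - a) | a in A].

Definition distortion N (r : R) P (A : set 'rV[R]_d) : \bar R :=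
  (\int[P]_x (dist_set N x A `^ r)%:E)%E.

(* Since [inf set0 = 0], [dist_set N x set0 = 0] and the empty codebook has   *)
(* distortion 0: it must be, and is, excluded from the infimum.               *)
Definition optimal_codebook N (r : R) P (n : nat) (A : set 'rV[R]_d) :=
  (A #<= `I_n)%card /\
  distortion N r P A =
    ereal_inf [set distortion N r P B | B in [set B | B !=set0 /\ (B #<= `I_n)%card]].

Definition is_density P h :=
  [/\ measurable_fun setT h, forall x, 0 <= h x &
      forall A, measurable A -> P A = (\int[lebesgue_rV R d]_(x in A) (h x)%:E)%E].

Definition PSP N f (rho : R) :=
  measurable_fun setT f /\
  exists s0 cf : R, [/\ 0 < s0, 0 < cf &
    forall x, ~ cnball N 0 rho x -> forall s, 0 < s < s0 ->
      (cf%:E * lebesgue_rV R d (nball N x s) <=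
       lebesgue_rV R d ([set y | (f y <= f x)%R] `&` nball N x s))%E].

(* Essential boundedness does not control [h] on null sets: the version of the *)
(* density on the ball of radius [rho], where no formula [g \o f] is imposed,  *)
(* may still be unbounded on a dense sequence, and then a bound by a negative *)
(* power of [h x] at every [x] fails. Boundedness of [h] at every point of    *)
(* that ball has to be assumed separately.                                    *)
Definition PSTP N P h (rho : R) :=
  [/\ is_density P h /\ (ess_supr (lebesgue_rV R d) (Num.norm \o h) < +oo)%E,
      forall t, 0 < t -> exists2 c, 0 < c & forall x, cnball N 0 t x -> c <= h x &
      exists f (I : interval R) (g : R -> R),
        [/\ forall x, f x \in I,
            PSP N f rho,
            {in I, forall a, 0 < g a},
            {in I &, {homo g : a b /~ a <= b}} &
            forall x, rho <= N x -> h x = g (f x)]].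

End quantization.

(* Main.v *)
Require Import Defs.
From mathcomp Require Import all_boot all_order all_algebra.
From mathcomp Require Import all_classical all_reals all_analysis.
From mathcomp Require Import measurable_realfun ess_sup_inf ring lra.

Import Order.TTheory GRing.Theory Num.Theory.
Import numFieldNormedType.Exports.

Set Implicit Arguments.
Unset Strict Implicit.
Unset Printing Implicit Defensive.

Local Open Scope classical_set_scope.
Local Open Scope ring_scope.

(** The proof compares the optimal codebook [alpha n] with the codebook obtained
    by deleting one of its points and adding the point [x]. Write
    [D = d(x, alpha n)], [eps = n ^ (- 1 / d)], and let [e] be the distortion of
    [alpha n].

    Adding [x] lowers [d(., A) ^ r] by at least a constant times [D ^ r] on the
    ball [B(x, D / 4)] ([distortion_add_le]), and the tail property gives this
    ball a mass of at least a constant times [h x * D ^ d], as long as [D] is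
    small ([PSTP_nball_ge]; it uses that [h] is bounded everywhere,
    [PSTP_bounded]). So the gain is at least [c * h x * D ^ (r + d)].

    For the loss, let [S] be a set of points of the codebook that have another
    point of the codebook within distance [sigma]. At a given [y], the distance
    to the codebook changes for at most one deletion, and then by at most
    [sigma]; hence the losses of the deletions of the points of [S] add up to at
    most [2 ^ r * (e + sigma ^ r)] ([sum_dist_rem_le]). By optimality each loss
    is at least the gain, so that
    [#|S| * c * h x * D ^ (r + d) <= 2 ^ r * (e + sigma ^ r)]
    ([optimal_swap_le]).

    It remains to see that [e = O(eps ^ r)] and that [S] has at least a constant
    times [n] points for some [sigma = O(eps)]. The first is Pierce's lemma
    ([optimal_distortion_le]): a product of one-dimensional grids whose gaps near
    [t] are of order [eps * (1 + |t|) ^ (1 + 1 / p)] has the required distortion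
    under the moment assumption. For the second ([size_close_points]), a ball
    about the origin has positive mass, and by Markov's inequality at least half
    of this mass lies within [O(eps)] of the codebook; as the density is bounded,
    this takes at least a constant times [n] points in a bounded region, and by
    the pigeonhole principle only a small part of them can be isolated at scale
    [sigma]. The resulting bound is [D ^ (r + d) * h x <= K * eps ^ (r + d)]. *)

(** * Norms on R^d *)

Section norm.
Context {R : realType} {d : nat}.
Variable N : 'rV[R]_d -> R.
Hypothesis hN : is_norm N.
Implicit Types (x y : 'rV[R]_d) (A B : set 'rV[R]_d).

Lemma is_normD x y : N (x + y) <= N x + N y.
Proof. by case: hN. Qed.

Lemma is_normN x : N (- x) = N x.
Proof. by case: hN => _ NZ _; rewrite -scaleN1r NZ normrN1 mul1r. Qed.

Lemma is_norm0 : N 0 = 0.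
Proof. by case: hN => _ NZ _; rewrite -(scale0r 0) NZ normr0 mul0r. Qed.

Lemma is_norm_ge0 x : 0 <= N x.
Proof.
have := is_normD x (- x); rewrite subrr is_norm0 is_normN -mulr2n.
by rewrite pmulrn_lge0.
Qed.

Lemma is_normC x y : N (x - y) = N (y - x).
Proof. by rewrite -is_normN opprB. Qed.

Lemma is_norm_trans y x z : N (x - z) <= N (x - y) + N (y - z).
Proof. by rewrite -[x - z](subrKA y) is_normD. Qed.

Lemma coord_le_normr x (i : 'I_d) : `|x ord0 i| <= `|x|.
Proof.
rewrite [leRHS]/Num.norm /= mx_normrE; apply/bigmax_geP; right.
by exists (ord0, i).
Qed.

Lemma normr_le_coord x (c : R) :
  0 <= c -> (forall i, `|x ord0 i| <= c) -> `|x| <= c.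
Proof.
move=> c0 xc; rewrite [leLHS]/Num.norm /= mx_normrE; apply/bigmax_leP.
by split=> // -[i j] _ /=; rewrite (ord1 i).
Qed.

Lemma is_norm_le_normr : exists2 C : R, 0 < C & forall x, N x <= C * `|x|.
Proof.
have [_ NZ _] := hN.
have sum_ge0 : 0 <= \sum_(i < d) N (delta_mx ord0 i).
  by apply: sumr_ge0 => i _; exact: is_norm_ge0.
exists (1 + \sum_(i < d) N (delta_mx ord0 i)) => [|x].
  by rewrite ltr_pwDl.
rewrite {1}(row_sum_delta x).
apply: (@le_trans _ _ (\sum_(i < d) N (x ord0 i *: delta_mx ord0 i))).
  elim/big_ind2: _ => [|a b a' b' ab a'b'|//]; first by rewrite is_norm0.
  by rewrite (le_trans (is_normD _ _))// lerD.
rewrite mulrDl mul1r mulr_suml -[leLHS]add0r lerD// ler_sum// => i _.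
by rewrite NZ mulrC ler_wpM2l ?is_norm_ge0// coord_le_normr.
Qed.

Lemma is_norm_dist x y : `|N x - N y| <= N (x - y).
Proof.
have := is_normD (x - y) y; have := is_normD (y - x) x.
by rewrite !subrK (is_normC y) ler_norml => ? ?; apply/andP; split; lra.
Qed.

(** [N]-Lipschitz functions are continuous for the sup-norm topology. *)
Lemma continuous_lipschitz_norm (f : 'rV[R]_d -> R) :
  (forall x y, f x - f y <= N (x - y)) -> continuous f.
Proof.
have [C C0 NC] := is_norm_le_normr => fN x.
apply/(@cvgrPdist_lt _ _ _ _ (nbhs_filter x)) => e e0; apply/nbhs_ballP.
exists (C^-1 * e) => [|y]; first by rewrite /= mulr_gt0// invr_gt0.
rewrite mx_norm_ball /ball_/= => xy.
have {}xy : N (x - y) < e by rewrite (le_lt_trans (NC _))// -ltr_pdivlMl.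
rewrite (le_lt_trans _ xy)// ler_norml fN andbT lerNl opprB.
by rewrite is_normC fN.
Qed.

Lemma continuous_is_norm : continuous N.
Proof.
apply: continuous_lipschitz_norm => x y.
exact: le_trans (ler_norm _) (is_norm_dist x y).
Qed.

Lemma normr_le_is_norm : exists2 C : R, 0 < C & forall x, `|x| <= C * N x.
Proof.
have [_ NZ N0] := hN.
(* [N] attains a positive minimum on the sup-norm unit sphere. *)
pose S := [set x : 'rV[R]_d | `|x| = 1].
have [[x0 Sx0]|S0] := pselect (S !=set0); last first.
  exists 1 => // x; have [->|x_neq0] := eqVneq x 0.
    by rewrite normr0 is_norm0 mulr0.
  exfalso; apply: S0; exists (`|x|^-1 *: x); rewrite /S/= normrZ normfV normr_id.
  by rewrite mulVf// normr_eq0.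
have cS : compact S.
  apply: bounded_closed_compact.
    by exists 1; split=> // y y1 x /= ->; exact: ltW.
  rewrite (_ : S = (fun x => `|x|) @^-1` [set 1])//.
  by apply: closed_comp; [move=> x _; exact: norm_continuous|exact: closed_eq].
have [|c cS' cmin] := @EVT_min_rV R d N S (ex_intro _ _ Sx0) cS.
  by apply: continuous_subspaceT => x; exact: continuous_is_norm.
have c1 : `|c| = 1 by move: cS'; rewrite inE.
have Nc : 0 < N c.
  rewrite lt_neqAle is_norm_ge0 andbT eq_sym; apply/eqP => /N0 c0.
  by move: c1; rewrite c0 normr0 => /eqP; rewrite eq_sym oner_eq0.
exists (N c)^-1 => [|x]; first by rewrite invr_gt0.
have [->|x_neq0] := eqVneq x 0; first by rewrite normr0 is_norm0 mulr0.
have x0' : 0 < `|x| by rewrite normr_gt0.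
have /cmin : `|x|^-1 *: x \in S.
  by rewrite inE /S/= normrZ normfV normr_id mulVf// gt_eqF.
rewrite NZ normfV normr_id => Ncx.
by rewrite mulrC ler_pdivlMr// -ler_pdivlMl.
Qed.

Lemma continuous_measurable_rV (f : 'rV[R]_d -> R) :
  continuous f -> measurable_fun setT f.
Proof.
move=> cf; apply: (measurability _ (RGenOpens.measurableE R)) => //.
move=> _ [_ [a [b ->] <-]]; rewrite setTI.
by apply: open_measurable_mx; apply: open_comp => //; exact: interval_open.
Qed.

Lemma measurable_nball x s : measurable (nball N x s).
Proof.
apply: open_measurable_mx.
rewrite (_ : nball N x s = (fun y => N (y - x)) @^-1` [set t | t < s])//.
apply: open_comp; last exact: open_lt.
move=> y _; apply: continuous_lipschitz_norm => {}y z.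
rewrite (le_trans (ler_norm _))// (le_trans (is_norm_dist _ _))//.
by rewrite opprB addrA subrK.
Qed.

(** * The distance to a codebook *)

Lemma dist_set_ge0 x A : 0 <= dist_set N x A.
Proof.
have [->|/set0P A0] := eqVneq A set0; first by rewrite /dist_set image_set0 inf0.
by apply: lb_le_inf => [|_ [a _ <-]]; [exact: image_nonempty|exact: is_norm_ge0].
Qed.

Lemma dist_set_le x A a : A a -> dist_set N x A <= N (x - a).
Proof.
move=> Aa; apply: ge_inf; last by exists a.
by exists 0 => _ [b _ <-]; exact: is_norm_ge0.
Qed.

Lemma le_dist_set x A c : A !=set0 ->
  (forall a, A a -> c <= N (x - a)) -> c <= dist_set N x A.
Proof.
move=> A0 cA; apply: lb_le_inf => [|_ [a Aa <-]]; last exact: cA.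
exact: image_nonempty.
Qed.

Lemma dist_set_lt x A c : A !=set0 -> dist_set N x A < c ->
  exists2 a, A a & N (x - a) < c.
Proof.
move=> A0 xc; apply: contrapT => noa.
suff : c <= dist_set N x A by rewrite leNgt xc.
apply: le_dist_set => // a Aa; rewrite leNgt; apply/negP => xa.
by apply: noa; exists a.
Qed.

Lemma dist_set_subset x A B : A !=set0 -> A `<=` B ->
  dist_set N x B <= dist_set N x A.
Proof. by move=> A0 AB; apply: le_dist_set => // a /AB; exact: dist_set_le. Qed.

Lemma dist_set_lip x y A : dist_set N x A <= dist_set N y A + N (x - y).
Proof.
have [->|/set0P A0] := eqVneq A set0.
  by rewrite /dist_set !image_set0 inf0 add0r is_norm_ge0.
rewrite -lerBlDr; apply: le_dist_set => // a Aa.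
rewrite lerBlDr (le_trans (dist_set_le x Aa))// [leRHS]addrC.
exact: is_norm_trans.
Qed.

Lemma measurable_dist_set A : measurable_fun setT (dist_set N ^~ A).
Proof.
apply: continuous_measurable_rV; apply: continuous_lipschitz_norm => x y.
by rewrite lerBlDl dist_set_lip.
Qed.

Lemma measurable_dist_set_ge (t : R) A :
  measurable [set x | t <= dist_set N x A].
Proof.
rewrite -[X in measurable X]setTI.
rewrite (_ : [set x | _] = (dist_set N ^~ A) @^-1` `[t, +oo[); last first.
  by apply/seteqP; split=> y /=; rewrite in_itv/= andbT.
by apply: measurable_dist_set => //; exact: measurable_itv.
Qed.

Lemma measurable_dist_powR (r : R) A :
  measurable_fun setT (fun x => (dist_set N x A `^ r)%:E).
Proof.
apply/measurable_EFinP; apply: (measurableT_comp (measurable_powR _)).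
exact: measurable_dist_set.
Qed.

End norm.

Section card.
Context {R : realType} {d : nat}.
Implicit Types A : set 'rV[R]_d.

Lemma card_le_II_seqP A n :
  (A #<= `I_n)%card <-> exists s, [/\ uniq s, (size s <= n)%N & A = [set` s]].
Proof.
split=> [An|[s [us sn ->]]].
  have fA : finite_set A by apply/finite_set_leP; exists n.
  exists (finmap.enum_fset (fset_set A)); split; first exact: finmap.fset_uniq.
    exact: geq_card_fset_set.
  by rewrite fset_setK.
apply: (@card_le_trans _ _ _ `I_(size s)); last by rewrite card_le_II.
apply/pcard_leP/injfunPex => /=; exists (index ^~ s) => x y /=.
  by rewrite index_mem.
by rewrite !inE => xs ys; apply: index_inj.
Qed.

End card.

(** * Lebesgue measure of balls *)

Section lebesgue_ball.
Context {R : realType}.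

(** The open sup-norm ball. The quantified form also covers dimension 0, where
    it makes the cube the whole one-point space. *)
Definition cube d (x : 'rV[R]_d) (s : R) : set 'rV[R]_d :=
  [set y | forall i, `|y ord0 i - x ord0 i| < s].

Lemma measurable_cube d (x : 'rV[R]_d) (s : R) : measurable (cube x s).
Proof.
rewrite (_ : cube x s = \bigcap_(i in [set: 'I_d])
    ((fun y : 'rV[R]_d => y ord0 i) @^-1`
     `]x ord0 i - s, x ord0 i + s[)); last first.
  apply/seteqP; split=> [y /= yz i _|y /= yz i]/=.
    by rewrite in_itv/= -ltr_distl.
  by have := yz i Logic.I; rewrite /= in_itv/= -ltr_distl.
apply: fin_bigcap_measurable => // i _.
rewrite -[X in measurable X]setTI.
by apply: (measurable_coord ord0 i) => //; exact: measurable_itv.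
Qed.

Lemma lebesgue_rV_cube d (x : 'rV[R]_d) (s : R) : 0 < s ->
  lebesgue_rV R d (cube x s) = ((2 * s) ^+ d)%:E.
Proof.
move=> s0; elim: d x => [|d IH] x.
  rewrite /= diracE mem_set ?expr0// => -[]//.
pose x' : 'rV[R]_d := \row_i x ord0 (lift ord0 i).
transitivity ((@lebesgue_measure R \x lebesgue_rV R d)%E
    (`]x ord0 ord0 - s, x ord0 ord0 + s[%classic `*`
     cube x' s)).
  rewrite /= /lebesgue_rVS /pushforward; congr (_ _).
  apply/seteqP; split=> [[a y] /= xy|[a y] /= [xa xy] i].
    split=> [|i].
      by have := xy ord0; rewrite cons_rV0 /= in_itv/= ltr_distl.
    by have := xy (lift ord0 i); rewrite cons_rVS /= mxE.
  have [->|[j ->]] : i = ord0 \/ exists j, i = lift ord0 j.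
  - by case: (unliftP ord0 i) => [j ->|->]; [right; exists j|left].
  - by move: xa; rewrite cons_rV0 /= in_itv/= ltr_distl.
  - by have := xy j; rewrite cons_rVS /= mxE.
rewrite product_measure1E; [|exact: measurable_itv|exact: measurable_cube].
rewrite IH exprS EFinM; congr (_ * _)%E.
apply: etrans (lebesgue_measure_itv _) _ => /=.
rewrite lte_fin ifT; last by lra.
by rewrite -EFinD; congr _%:E; ring.
Qed.

Variables (d : nat) (N : 'rV[R]_d -> R).
Hypothesis hN : is_norm N.

Lemma lebesgue_nball_le : exists2 C : R, 0 < C & forall x s, 0 < s ->
  (lebesgue_rV R d (nball N x s) <= (C * s ^+ d)%:E)%E.
Proof.
have [C C0 NC] := normr_le_is_norm hN.
exists ((2 * C) ^+ d) => [|x s s0]; first by rewrite exprn_gt0// mulr_gt0.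
rewrite -exprMn -mulrA -(lebesgue_rV_cube x) ?mulr_gt0//.
have mB := measurable_nball hN x s.
rewrite le_measure ?inE// => [|y xy i].
  exact: measurable_cube.
have := coord_le_normr (y - x) i; rewrite !mxE => /le_lt_trans; apply.
by rewrite (le_lt_trans (NC _))// ltr_pM2l.
Qed.

Lemma lebesgue_nball_ge : exists2 c : R, 0 < c & forall x s, 0 < s ->
  ((c * s ^+ d)%:E <= lebesgue_rV R d (nball N x s))%E.
Proof.
have [C C0 NC] := is_norm_le_normr hN.
exists (C^-1 ^+ d) => [|x s s0]; first by rewrite exprn_gt0// invr_gt0.
have sC : 0 < s / C / 2 by rewrite !divr_gt0.
rewrite -exprMn (_ : C^-1 * s = 2 * (s / C / 2)); last by field; rewrite gt_eqF.
rewrite -(lebesgue_rV_cube x)//.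
have mB := measurable_nball hN x s.
rewrite le_measure ?inE// => [|y /= xy].
  exact: measurable_cube.
have xy' : `|y - x| <= s / C / 2.
  apply: normr_le_coord => [|i]; first exact: ltW.
  by rewrite !mxE ltW.
rewrite /nball/= (le_lt_trans (NC _))// (@le_lt_trans _ _ (s / 2))//.
  by rewrite -ler_pdivlMl// (le_trans xy')// mulrAC [leRHS]mulrC.
by rewrite ltr_pdivrMr// ltr_pMr// ltr1n.
Qed.

End lebesgue_ball.

(** * Consequences of the peakless sublevel tail property *)

Lemma measurable_sublevel {R : realType} {d : nat} (f : 'rV[R]_d -> R) (a : R) :
  measurable_fun setT f -> measurable [set x | f x <= a].
Proof.
move=> mf; rewrite -[X in measurable X]setTI.
rewrite (_ : [set x | _] = f @^-1` `]-oo, a]); last first.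
  by apply/seteqP; split=> x /=; rewrite in_itv.
by apply: mf => //; exact: measurable_itv.
Qed.

Section density.
Context {R : realType} {d : nat}.
Variables (N : 'rV[R]_d -> R) (P : probability 'rV[R]_d R) (h : 'rV[R]_d -> R).
Hypotheses (hN : is_norm N) (hP : is_density P h).

Lemma density_ge (a : R) A : measurable A -> 0 <= a ->
  (forall x, A x -> a <= h x) -> (a%:E * lebesgue_rV R d A <= P A)%E.
Proof.
case: hP => mh h0 PE mA a0 ah.
rewrite PE// -integral_cst//; apply: ge0_le_integral => //.
by apply/measurable_EFinP; exact: measurable_funTS.
Qed.

Lemma density_le (M : R) A : measurable A -> (forall x, h x <= M) ->
  (P A <= M%:E * lebesgue_rV R d A)%E.
Proof.
case: hP => mh h0 PE mA hM.
rewrite PE// -integral_cst//; apply: ge0_le_integral => //.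
- by move=> x _; rewrite lee_fin.
- by apply/measurable_EFinP; exact: measurable_funTS.
- by move=> x _; rewrite lee_fin.
Qed.

End density.

Section PSTP.
Context {R : realType} {d : nat}.
Variables (N : 'rV[R]_d -> R) (P : probability 'rV[R]_d R).
Variables (h : 'rV[R]_d -> R) (rho : R).
Hypotheses (hN : is_norm N) (hP : PSTP N P h rho).

Lemma PSTP_density : is_density P h.
Proof. by case: hP => -[]. Qed.

Lemma PSTP_compact t : exists2 c : R, 0 < c & forall x, N x <= t -> c <= h x.
Proof.
case: hP => _ hc _; have [|c c0 cP] := hc (Num.max t 1).
  by rewrite lt_max ltr01 orbT.
exists c => // x xt; apply: cP.
by rewrite /cnball/= subr0 le_max xt.
Qed.

(** Outside the ball of radius [rho], every value of [h] is at most the values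
    that [h] takes on a set of positive measure. *)
Lemma PSTP_bounded : (exists M : R, forall x, cnball N 0 rho x -> h x <= M) ->
  exists2 M : R, 0 < M & forall x, h x <= M.
Proof.
move=> [M0 hM0].
have [[[mh h0 _] /ess_supr_bounded[M1 [Z [mZ Z0 hM1]]]] _] := hP.
case=> f [I [g [fI [mf [s0 [cf [s00 cf0 PSPf]]]] g0 gni hE]]].
exists (`|M0| + `|M1| + 1) => [|x]; first by rewrite ltr_wpDl// addr_ge0.
have [xrho|xrho] := leP (N x) rho.
  have /hM0 : cnball N 0 rho x by rewrite /cnball/= subr0.
  have := ler_norm M0; have := normr_ge0 M1; lra.
suff [y [fy xy hy]] : exists y, [/\ f y <= f x, rho < N y & `|h y| <= M1].
  have hxy : h x <= h y.
    by rewrite (hE _ (ltW xrho)) (hE y (ltW xy)); exact: gni.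
  have := ler_norm M1; have := normr_ge0 M0; have := ler_norm (h y); lra.
(* With this radius the ball about [x] stays outside the ball of radius [rho]. *)
pose s := Num.min (s0 / 2) (N x - rho).
have s_gt0 : 0 < s by rewrite lt_min divr_gt0//= subr_gt0.
have ss0 : s < s0.
  by rewrite gt_min ltr_pdivrMr// ltr_pMr// ltr1n.
have nx : ~ cnball N 0 rho x.
  by rewrite /cnball/= subr0; apply/negP; rewrite -ltNge.
have /(PSPf x nx) PSPx : 0 < s < s0 by rewrite s_gt0.
apply: contrapT => noy.
set E := _ `&` _ in PSPx.
have EZ : E `<=` Z.
  move=> y [/= fyx xy]; apply: hM1 => /= hy; apply: noy; exists y; split=> //.
  have := is_norm_trans hN y x 0.
  have : N (y - x) < N x - rho by rewrite (lt_le_trans xy)// ge_min lexx orbT.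
  by rewrite !subr0 (is_normC hN y); lra.
have mE : measurable E.
  by apply: measurableI; [exact: measurable_sublevel|exact: measurable_nball].
have E0 : lebesgue_rV R d E = 0.
  by apply/eqP; rewrite eq_le measure_ge0 andbT -Z0 le_measure ?inE.
have [c c0 cB] := lebesgue_nball_ge hN.
move: PSPx; rewrite E0; apply/negP; rewrite -ltNge.
rewrite mule_gt0 ?lte_fin// (lt_le_trans _ (cB _ _ _))//.
by rewrite lte_fin mulr_gt0// exprn_gt0.
Qed.

(** The lower bound on the mass of small balls, uniform over all centres. If
    [N x > rho], then outside the ball of radius [rho] the sublevel set of [f] at
    [x] is contained in the set where [h] is at least [h x]; on the ball of
    radius [rho + 1], [h] is at least a constant [c1], hence at least
    [(c1 / M) * h x]. *)
Lemma PSTP_nball_ge : (exists M : R, forall x, cnball N 0 rho x -> h x <= M) ->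
  exists c s1 : R, [/\ 0 < c, 0 < s1 &
    forall x s, 0 < s < s1 -> ((c * h x * s ^+ d)%:E <= P (nball N x s))%E].
Proof.
move=> /PSTP_bounded[M M0 hM].
have dP := PSTP_density; have [_ h0 _] := dP.
have [c1 c10 c1P] := PSTP_compact (rho + 1).
have [l l0 lP] := lebesgue_nball_ge hN.
have [_ _ [f [I [g [fI [mf [s0 [cf [s00 cf0 PSPf]]]] g0 gni hE]]]]] := hP.
pose k := Num.min 1 (c1 / M).
have k0 : 0 < k by rewrite lt_min ltr01 divr_gt0.
have kh x : k * h x <= h x by rewrite ler_piMl// ge_min lexx.
have kc x : k * h x <= c1.
  rewrite (@le_trans _ _ (c1 / M * h x))//; first by rewrite ler_wpM2r// ge_min lexx orbT.
  by rewrite mulrAC ler_pdivrMr// ler_pM2l.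
exists (k * Num.min cf 1 * l), (Num.min s0 1); split.
- by rewrite !mulr_gt0// lt_min cf0 ltr01.
- by rewrite lt_min s00 ltr01.
move=> x s /andP[s_gt0]; rewrite lt_min => /andP[ss0 s1].
have mB := measurable_nball hN x s.
have kh0 : 0 <= k * h x by rewrite mulr_ge0// ltW.
have m0 : 0 <= Num.min cf 1 by rewrite le_min ltW//= ler01.
have hB : ((Num.min cf 1 * (l * s ^+ d))%:E <=
           (Num.min cf 1)%:E * lebesgue_rV R d (nball N x s))%E.
  by rewrite EFinM lee_wpmul2l ?lee_fin// lP.
suff [E [mE EB hE']] : exists E : set 'rV[R]_d, [/\ measurable E,
    E `<=` nball N x s /\ (forall y, E y -> k * h x <= h y) &
    ((Num.min cf 1)%:E * lebesgue_rV R d (nball N x s) <= lebesgue_rV R d E)%E].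
  case: EB => EB Eh.
  apply: (@le_trans _ _ (P E)); last by rewrite le_measure ?inE.
  apply: le_trans (density_ge dP mE kh0 Eh).
  have -> : k * Num.min cf 1 * l * h x * s ^+ d =
      k * h x * (Num.min cf 1 * (l * s ^+ d)).
    by move: (Num.min _ _) (_ ^+ _) => a b; ring.
  by rewrite EFinM lee_wpmul2l ?lee_fin// (le_trans hB).
have [xrho|xrho] := leP (N x) rho.
  exists (nball N x s); split=> //.
    split=> // y; rewrite /nball/= => xy.
    rewrite (le_trans (kc x))// c1P//.
    by have := is_norm_trans hN x y 0; rewrite !subr0; lra.
  by rewrite -[leRHS]mul1e lee_wpmul2r// lee_fin ge_min lexx orbT.
exists ([set y | f y <= f x] `&` nball N x s); split.
- by apply: measurableI => //; exact: measurable_sublevel.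
- split=> [y [] //|y [/= fyx xy]].
  have [yrho|yrho] := leP (N y) rho.
    by rewrite (le_trans (kc x))// c1P//; lra.
  rewrite (le_trans (kh x))// (hE _ (ltW xrho)) (hE _ (ltW yrho)).
  exact: gni.
- apply: le_trans (PSPf x _ s _); last by rewrite s_gt0.
    by rewrite lee_wpmul2r// lee_fin ge_min lexx.
  by rewrite /cnball/= subr0; apply/negP; rewrite -ltNge.
Qed.

End PSTP.

(** * The order of convergence of the optimal distortion *)

Section node.
Context {R : realType}.

(** The mean value bound for powers, multiplied by [v] so that no predecessor of
    the exponent [p] appears. *)
Lemma exprB_le (p : nat) (v w : R) : 0 <= w -> w <= v ->
  v * (v ^+ p - w ^+ p) <= p%:R * v ^+ p * (v - w).
Proof.
move=> w0 wv; have v0 := le_trans w0 wv.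
elim: p => [|p IH]; first by rewrite !expr0 subrr mulr0 mul0r mul0r.
rewrite (_ : v * _ = v * (v * (v ^+ p - w ^+ p)) + w ^+ p * v * (v - w)); last first.
  by rewrite !exprS; ring.
rewrite (_ : p.+1%:R * _ * _ =
    v * (p%:R * v ^+ p * (v - w)) + v ^+ p * v * (v - w)); last first.
  by rewrite -natr1 exprS; ring.
rewrite lerD ?ler_wpM2l// !ler_wpM2r ?subr_ge0//.
by rewrite lerXn2r ?nnegrE.
Qed.

(** The points [+-((m / k) ^ p - 1)], [1 <= k <= m]: a grid on the line whose
    gaps near [t] are of order [(1 + |t|) ^ (1 + 1 / p) / m]. *)
Definition node (p m : nat) (a : bool * 'I_m) : R :=
  (-1) ^+ a.1 * ((m%:R / a.2.+1%:R) ^+ p - 1).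

Lemma nodeP (p m : nat) (t : R) : (0 < p)%N -> (0 < m)%N ->
  exists a : bool * 'I_m,
    `|t - node p a| <= p%:R / m%:R * (1 + `|t|) `^ (1 + p%:R^-1).
Proof.
move=> p0 m0; have p0' : p%:R != 0 :> R by rewrite pnatr_eq0 -lt0n.
have m0' : 0 < m%:R :> R by rewrite ltr0n.
have t1 : 1 <= 1 + `|t| by rewrite lerDl.
pose v := (1 + `|t|) `^ p%:R^-1.
have v1 : 1 <= v.
  by rewrite -(powRr0 (1 + `|t|)) ler_powR ?invr_ge0.
have v0 : 0 < v by rewrite (lt_le_trans ltr01).
have vp : v ^+ p = 1 + `|t|.
  rewrite -powR_mulrn; last exact: ltW.
  by rewrite /v -powRrM mulVf// powRr1// (le_trans ler01).
have -> : (1 + `|t|) `^ (1 + p%:R^-1) = v ^+ p * v.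
  rewrite powRD; last by rewrite (gt_eqF (lt_le_trans ltr01 t1)) implybT.
  by rewrite powRr1 ?vp// (le_trans ler01).
have mv0 : 0 <= m%:R / v by rewrite divr_ge0 ?ltW.
have mvm : m%:R / v <= m%:R by rewrite ler_pdivrMr// ler_pMr.
(* [k = i + 1] is the truncation of [m / v] plus one, capped at [m]. *)
have [i [ki ik]] : exists i : 'I_m, m%:R / v <= i.+1%:R /\ i%:R <= m%:R / v.
  have /andP[j1 j2] := truncn_itv mv0.
  have [jm|mj] := ltnP (Num.truncn (m%:R / v)) m.
    by exists (Ordinal jm); split => //=; exact: ltW.
  have m1m : (m.-1 < m)%N by rewrite prednK.
  exists (Ordinal m1m); rewrite /= prednK//; split=> //.
  by rewrite (le_trans _ j1)// ler_nat (leq_trans _ mj)// leq_pred.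
pose w := m%:R / i.+1%:R : R.
have i0 : 0 < i.+1%:R :> R by rewrite ltr0n.
have w0 : 0 < w by rewrite divr_gt0.
have wv : w <= v.
  by rewrite ler_pdivrMr// mulrC -ler_pdivrMr.
have vw : v - w <= v * v / m%:R.
  have -> : v - w = (i.+1%:R - m%:R / v) * (v * w / m%:R).
    by rewrite /w; field; rewrite !gt_eqF.
  apply: (@le_trans _ _ (1 * (v * w / m%:R))).
    apply: ler_wpM2r; first by rewrite divr_ge0// mulr_ge0// ltW.
    by rewrite lerBlDr -natr1 addrC lerD2l.
  rewrite mul1r; apply: ler_wpM2r; first by rewrite invr_ge0 ltW.
  by apply: ler_wpM2l => //; exact: ltW.
have vwp : `|t| - (w ^+ p - 1) = v ^+ p - w ^+ p by rewrite vp; ring.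
have vwp0 : 0 <= v ^+ p - w ^+ p.
  by rewrite subr_ge0 lerXn2r ?nnegrE// ltW.
exists (t < 0, i); rewrite /node /= -/w.
have -> : `|t - (-1) ^+ (t < 0)%R * (w ^+ p - 1)| = v ^+ p - w ^+ p.
  rewrite -vwp; have [t0|t0] := ltP t 0.
    rewrite expr1 mulN1r opprK -normrN opprD (ltr0_norm t0) ger0_norm//.
    by rewrite -(ltr0_norm t0) vwp.
  by rewrite expr0 mul1r (ger0_norm t0) ger0_norm// -{1}(ger0_norm t0) vwp.
rewrite -(ler_pM2l v0) (le_trans (exprB_le _ (ltW w0) wv))//.
rewrite (_ : _ * (_ * _) = p%:R * v ^+ p * (v * v / m%:R)); last first.
  by field; rewrite gt_eqF.
by rewrite ler_wpM2l// mulr_ge0// exprn_ge0// ltW.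
Qed.

(** Products of the one-dimensional grids. *)
Lemma grid_codebook (d p m : nat) : (0 < p)%N -> (0 < m)%N ->
  exists B : set 'rV[R]_d, [/\ B !=set0, (B #<= `I_((2 * m) ^ d))%card &
    forall x, exists2 b, B b &
      `|x - b| <= p%:R / m%:R * (1 + `|x|) `^ (1 + p%:R^-1)].
Proof.
move=> p0 m0.
pose F (phi : {ffun 'I_d -> bool * 'I_m}) : 'rV[R]_d := \row_i node p (phi i).
exists [set` undup (codom F)]; split.
- exists (F [ffun=> (true, Ordinal m0)]) => /=.
  by rewrite mem_undup codom_f.
- apply/card_le_II_seqP; exists (undup (codom F)); split=> //.
    exact: undup_uniq.
  rewrite (leq_trans (size_undup _))// size_codom card_ffun card_prod card_bool.
  by rewrite !card_ord.
- move=> x.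
  have /choice[a aP] : forall i, exists a : bool * 'I_m, `|x ord0 i - node p a| <=
      p%:R / m%:R * (1 + `|x ord0 i|) `^ (1 + p%:R^-1).
    by move=> i; exact: nodeP.
  exists (F [ffun i => a i]); first by rewrite /= mem_undup codom_f.
  apply: normr_le_coord => [|i]; first by rewrite mulr_ge0// ?divr_ge0// powR_ge0.
  rewrite !mxE ffunE (le_trans (aP i))// ler_wpM2l ?divr_ge0//.
  rewrite ge0_ler_powR ?nnegrE ?addr_ge0 ?invr_ge0//.
  by rewrite lerD2l coord_le_normr.
Qed.

End node.

Section pierce.
Context {R : realType} {d : nat}.
Variables (N : 'rV[R]_d -> R) (P : probability 'rV[R]_d R) (r delta : R).
Hypotheses (hN : is_norm N) (r0 : 0 < r) (delta0 : 0 < delta).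
Hypothesis moment : (\int[P]_x (N x `^ (r + delta))%:E < +oo)%E.

Lemma measurable_norm_powR q : measurable_fun setT (fun x => (N x `^ q)%:E).
Proof.
apply/measurable_EFinP; apply: (measurableT_comp (measurable_powR _)).
by apply: continuous_measurable_rV; exact: continuous_is_norm.
Qed.

(** Pierce's lemma: the optimal distortion is of order at most [n ^ (- r / d)],
    here with [eps = n ^ (- 1 / d)]. *)
Lemma optimal_distortion_le : exists2 C : R, 0 < C &
  forall n eps A, 0 < eps -> 2 * eps <= 1 -> eps ^+ d * n%:R = 1 ->
    optimal_codebook N r P n A -> (distortion N r P A <= (C * eps `^ r)%:E)%E.
Proof.
have [C1 C10 NC1] := is_norm_le_normr hN.
have [C2 C20 NC2] := normr_le_is_norm hN.
(* Large enough for [(1 + 1 / p) * r <= r + delta]. *)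
pose p := (Num.truncn (r / delta)).+1.
have rp : r / p%:R <= delta.
  rewrite ler_pdivrMr ?ltr0n// mulrC -ler_pdivrMr// ltW//.
  by have /andP[] := truncn_itv (ltW (divr_gt0 r0 delta0)).
pose q := r + delta.
have q0 : 0 < q by rewrite addr_gt0.
pose J := fine (\int[P]_x (N x `^ q)%:E).
have J0 : 0 <= J by apply: fine_ge0; apply: integral_ge0 => x _; rewrite lee_fin powR_ge0.
have JE : (\int[P]_x (N x `^ q)%:E = J%:E)%E.
  rewrite fineK// ge0_fin_numE//.
  by apply: integral_ge0 => x _; rewrite lee_fin powR_ge0.
pose K := (C1 * (p%:R * 4)) `^ r * (1 + C2) `^ q.
have K0 : 0 < K by rewrite mulr_gt0// powR_gt0// ?mulr_gt0// ?ltr0n// addr_gt0.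
exists (K * (1 + J)); first by rewrite mulr_gt0// ltr_pwDl.
move=> n eps A eps0 eps2 epsn [_ ->].
pose m := Num.truncn (2 * eps)^-1.
have e2 : 0 < 2 * eps by rewrite mulr_gt0.
have /andP[m1 m2] : m%:R <= (2 * eps)^-1 < m.+1%:R.
  by apply: truncn_itv; rewrite invr_ge0 ltW.
have m0 : (0 < m)%N.
  by rewrite -ltnS -(ltr_nat R) (le_lt_trans _ m2)// invf_ge1.
have m4 : m%:R^-1 <= 4 * eps.
  rewrite -[leRHS]invrK lef_pV2 ?posrE ?ltr0n ?invr_gt0 ?mulr_gt0//.
  have : (2 * eps)^-1 <= 2 * m%:R.
    by rewrite (le_trans (ltW m2))// -natrM ler_nat mul2n -addnn -addn1 leq_add2l.
  rewrite (_ : (4 * eps)^-1 = (2 * eps)^-1 / 2); first by lra.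
  by field; rewrite gt_eqF.
have mn : ((2 * m) ^ d <= n)%N.
  have epsd : 0 < eps ^+ d by rewrite exprn_gt0.
  rewrite -(ler_nat R) -(ler_pM2r epsd) [leRHS]mulrC epsn natrX -exprMn.
  rewrite exprn_ile1// ?mulr_ge0 ?(ltW eps0)//.
  rewrite natrM mulrAC -ler_pdivlMl//.
  by rewrite mulr1.
have p0 : (0 < p)%N by [].
have [B [B0 Bm BP]] := grid_codebook d p0 m0 (R := R).
apply: (@le_trans _ _ (distortion N r P B)).
  apply: ereal_inf_lbound; exists B => //; split=> //.
  by apply: card_le_trans Bm _; rewrite card_le_II.
apply: (@le_trans _ _ (\int[P]_x ((K * eps `^ r)%:E * (1 + (N x `^ q)%:E)))%E).
  apply: ge0_le_integral => //.
  - by move=> x _; rewrite lee_fin powR_ge0.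
  - exact: measurable_dist_powR.
  - apply: measurable_funeM; apply: emeasurable_funD => //.
    exact: measurable_norm_powR.
  move=> x _; have [b Bb xb] := BP x.
  rewrite -EFinD -EFinM lee_fin.
  have Nx0 := is_norm_ge0 hN x.
  have xC : 1 + `|x| <= 1 + C2 * N x by rewrite lerD2l NC2.
  have x0 : 1 <= 1 + `|x| by rewrite lerDl.
  have dxB : dist_set N x B <= C1 * (p%:R * 4) * eps * (1 + C2 * N x) `^ (1 + p%:R^-1).
    rewrite (le_trans (dist_set_le hN _ Bb))// (le_trans (NC1 _))//.
    rewrite -!mulrA ler_pM2l// (le_trans xb)// -mulrA ler_pM2l ?ltr0n//.
    rewrite mulrA; apply: ler_pM => //; try exact: powR_ge0.
    have e1 : 0 <= 1 + p%:R^-1 :> R by rewrite addr_ge0.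
    apply: (ge0_ler_powR e1) => //; rewrite nnegrE (le_trans ler01)//.
    by rewrite (le_trans x0).
  apply: (@le_trans _ _ ((C1 * (p%:R * 4) * eps * (1 + C2 * N x) `^ (1 + p%:R^-1)) `^ r)).
    by rewrite ge0_ler_powR ?nnegrE ?(ltW r0)// ?dist_set_ge0// (le_trans _ dxB)// dist_set_ge0.
  have CN0 : 1 <= 1 + C2 * N x by rewrite lerDl mulr_ge0// ltW.
  rewrite powRM ?powR_ge0 ?mulr_ge0 ?(ltW C10) ?(ltW eps0)//.
  rewrite powRM ?mulr_ge0 ?(ltW C10) ?(ltW eps0)// -powRrM.
  rewrite /K [leRHS](_ : _ = (C1 * (p%:R * 4)) `^ r * eps `^ r *
    ((1 + C2) `^ q * (1 + N x `^ q))); last by ring.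
  rewrite ler_wpM2l ?mulr_ge0 ?powR_ge0//.
  apply: (@le_trans _ _ ((1 + C2 * N x) `^ q)).
    by rewrite ler_powR// mulrDl mul1r /q lerD2l mulrC.
  have q0' := ltW q0.
  have [N1|N1] := leP (N x) 1.
    apply: (@le_trans _ _ ((1 + C2) `^ q)).
      rewrite (ge0_ler_powR q0') ?nnegrE ?addr_ge0 ?mulr_ge0 ?(ltW C20)//.
      by rewrite lerD2l ler_piMr// ltW.
    by rewrite ler_peMr ?powR_ge0// lerDl powR_ge0.
  apply: (@le_trans _ _ (((1 + C2) * N x) `^ q)).
    rewrite (ge0_ler_powR q0') ?nnegrE ?addr_ge0 ?mulr_ge0 ?addr_ge0 ?(ltW C20)//.
    by rewrite mulrDl mul1r lerD2r ltW.
  rewrite powRM ?addr_ge0 ?(ltW C20)//.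
  by rewrite ler_wpM2l ?powR_ge0// lerDr.
rewrite ge0_integralZl ?lee_fin//; last 3 first.
- apply: emeasurable_funD => //; exact: measurable_norm_powR.
- by move=> x _; rewrite adde_ge0// lee_fin powR_ge0.
- by rewrite mulr_ge0 ?powR_ge0// ltW.
rewrite ge0_integralD//; last 2 first.
- by move=> x _; rewrite lee_fin powR_ge0.
- exact: measurable_norm_powR.
rewrite JE integral_cst//= mul1e [P setT]probability_setT -EFinD -EFinM lee_fin.
by rewrite le_eqVlt; apply/orP; left; apply/eqP; ring.
Qed.

End pierce.

(** * Codebooks with many close pairs *)

Lemma sume_ge_const {R : realType} {T : eqType} (S : seq T) (c : \bar R)
    (F : T -> \bar R) : (forall a, a \in S -> (c <= F a)%E) ->
  ((size S)%:R%:E * c <= \sum_(a <- S) F a)%E.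
Proof.
elim: S => [|a S IH] cF; first by rewrite big_nil mul0e.
rewrite big_cons /= -natr1 addrC EFinD ge0_muleDl ?lee_fin// mul1e leeD//.
  by apply: cF; rewrite mem_head.
by apply: IH => b bS; apply: cF; rewrite in_cons bS orbT.
Qed.

Section codebook.
Context {R : realType} {d : nat}.
Variables (N : 'rV[R]_d -> R) (P : probability 'rV[R]_d R) (r : R).
Hypotheses (hN : is_norm N) (r0 : 0 < r).
Implicit Types (s S : seq 'rV[R]_d) (x y a b : 'rV[R]_d).

Lemma dist_set_markov (t : R) A : 0 < t ->
  ((t `^ r)%:E * P [set x | (t <= dist_set N x A)%R] <= distortion N r P A)%E.
Proof.
move=> t0; set E := [set x | _].
have mE : measurable E by exact: measurable_dist_set_ge.
rewrite -integral_cst//; apply: (@le_trans _ _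
    (\int[P]_(x in E) (dist_set N x A `^ r)%:E)%E).
  apply: ge0_le_integral => //.
  - by move=> x _; rewrite lee_fin powR_ge0.
  - by apply: measurable_funTS; exact: measurable_dist_powR.
  - move=> x; rewrite /E/= lee_fin => tx.
    by rewrite ge0_ler_powR ?nnegrE ?(ltW r0)// ?(ltW t0)// dist_set_ge0.
apply: ge0_subset_integral => //; first exact: measurable_dist_powR.
by move=> x _; rewrite lee_fin powR_ge0.
Qed.

Lemma measure_bigU_nball_le s t (c : \bar R) :
  (forall a, P (nball N a t) <= c)%E ->
  (P (\big[setU/set0]_(a <- s) nball N a t) <= (size s)%:R%:E * c)%E.
Proof.
move=> Pc; elim: s => [|a s IH]; first by rewrite big_nil measure0 mul0e.
rewrite big_cons (le_trans (measureU2 _ _ _))//.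
- exact: measurable_nball.
- by apply: bigsetU_measurable => b _; exact: measurable_nball.
rewrite /= -natr1 addrC EFinD ge0_muleDl ?lee_fin// mul1e.
by rewrite leeD.
Qed.

(** Lower bound on the number of points of a codebook near the origin. *)
Lemma prob_nball_le (c q t : R) s : 0 < t -> s != [::] ->
  (forall a, P (nball N a t) <= c%:E)%E ->
  (P (nball N 0 q) <= (t `^ - r)%:E * distortion N r P [set` s] +
    ((size [seq a <- s | (N a < q + t)%R])%:R * c)%:E)%E.
Proof.
move=> t0 s0 Pc; set T := [seq a <- s | _]; set A := [set` s].
have A0 : A !=set0.
  by case: {T} s s0 @A => // a s _; exists a; rewrite /= mem_head.
pose E := [set x | t <= dist_set N x A].
pose U := \big[setU/set0]_(a <- T) nball N a t.
have mE : measurable E by exact: measurable_dist_set_ge.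
have mU : measurable U.
  by apply: bigsetU_measurable => b _; exact: measurable_nball.
apply: (@le_trans _ _ (P (E `|` U))).
  rewrite le_measure ?inE//; [exact: measurable_nball|exact: measurableU|].
  move=> x; rewrite /nball/= subr0 => xq.
  have [tx|/(dist_set_lt A0)[a /= sa xa]] := leP t (dist_set N x A).
    by left.
  right; rewrite /U -bigcup_seq; exists a => /=.
    rewrite mem_filter sa andbT.
    have := is_norm_trans hN x a 0; rewrite !subr0 (is_normC hN a); lra.
  by rewrite /nball/=.
rewrite (le_trans (measureU2 _ _ _))// leeD//.
  by rewrite powRN lee_pdivlMl ?powR_gt0// dist_set_markov.
by rewrite EFinM measure_bigU_nball_le.
Qed.

(** Pigeonhole principle: a [sigma]-separated family in a box. *)
Lemma size_separated (C L sigma : R) m s : (0 < m)%N -> 0 < L -> 0 < C ->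
  (forall x, N x <= C * `|x|) -> uniq s -> {in s, forall a, `|a| <= L} ->
  {in s &, forall a b, a != b -> sigma < N (a - b)} ->
  C * (2 * L / m%:R) <= sigma -> (size s <= m.+1 ^ d)%N.
Proof.
move=> m0 L0 C0 NC us sL ssep Csigma.
have m0' : 0 < m%:R :> R by rewrite ltr0n.
pose z a i := (a ord0 i + L) * (m%:R / (2 * L)).
have zm a i : a \in s -> 0 <= z a i <= m%:R.
  move=> /sL aL.
  have /ler_normlP[a1 a2] := le_trans (coord_le_normr a i) aL.
  have k0 : 0 < m%:R / (2 * L) by rewrite divr_gt0// mulr_gt0.
  rewrite mulr_ge0 ?(ltW k0)//=; last by lra.
  rewrite /z mulrA ler_pdivrMr ?mulr_gt0// mulrC ler_pM2l//; lra.
(* Points with the same integer parts of rescaled coordinates are close. *)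
pose F a : {ffun 'I_d -> 'I_m.+1} := [ffun i => inord (Num.truncn (z a i))].
have Finj : {in s &, injective F}.
  move=> a b sa sb Fab; apply/eqP; apply: contraT => ab.
  have := ssep _ _ sa sb ab; rewrite ltNge => /negP; case.
  apply: le_trans (NC _) _; apply: le_trans Csigma.
  rewrite ler_pM2l//; apply: normr_le_coord => [|i].
    by rewrite divr_ge0 ?mulr_ge0 ?(ltW L0)// ltW.
  rewrite !mxE.
  have /andP[a0 am] := zm a i sa; have /andP[b0 bm] := zm b i sb.
  have le_m (u : R) : 0 <= u <= m%:R -> (Num.truncn u < m.+1)%N.
    move=> /andP[u0 um]; rewrite ltnS -(ler_nat R).
    by rewrite (le_trans _ um)//; have /andP[] := truncn_itv u0.
  have tab : Num.truncn (z a i) = Num.truncn (z b i).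
    have /ffunP/(_ i) := Fab; rewrite !ffunE => /(congr1 val).
    by rewrite /= !inordK ?le_m ?zm.
  have /andP[a1 a2] := truncn_itv a0; have /andP[b1 b2] := truncn_itv b0.
  have zab : `|z a i - z b i| <= 1.
    move: a1 a2; rewrite tab -natr1 => a1 a2; move: b2; rewrite -natr1 => b2.
    by rewrite ler_norml; apply/andP; split; lra.
  have -> : a ord0 i - b ord0 i = 2 * L / m%:R * (z a i - z b i).
    by rewrite /z; field; rewrite !gt_eqF.
  rewrite normrM ger0_norm ?divr_ge0 ?mulr_ge0 ?(ltW L0) ?(ltW m0')//.
  by rewrite ler_piMr// divr_ge0 ?mulr_ge0 ?(ltW L0) ?(ltW m0').
rewrite -(size_map F) (leq_trans (uniq_leq_size _ (s2 := enum {: {ffun 'I_d -> 'I_m.+1}}) _))//.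
- by rewrite map_inj_in_uniq.
- by move=> f _; rewrite mem_enum.
- by rewrite -cardE card_ffun !card_ord.
Qed.

(** The points of the codebook that have another point within [sigma]. *)
Definition close_points (sigma : R) s :=
  [seq a <- s | has (fun b => (b != a) && (N (a - b) <= sigma)) s].

(** If the distortion is of the optimal order, a positive proportion of the
    points of the codebook have another one within [O(n ^ (- 1 / d))]: at least
    [c * n] of its points lie in a fixed box, and at most half that number can
    be separated at this scale. *)
Lemma size_close_points (M p q C : R) : (0 < d)%N -> 0 < M -> 0 < p -> 0 < C ->
  (forall x (t : R), 0 < t -> (P (nball N x t) <= (M * t ^+ d)%:E)%E) ->
  (p%:E <= P (nball N 0 q))%E ->
  exists c sigma eps0 : R, [/\ 0 < c, 0 < sigma, 0 < eps0 &
    forall n eps s, 0 < eps <= eps0 -> eps ^+ d * n%:R = 1 -> uniq s ->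
      s != [::] -> (distortion N r P [set` s] <= (C * eps `^ r)%:E)%E ->
      c * n%:R <= (size (close_points (sigma * eps) s))%:R].
Proof.
move=> d0 M0 p0 C0 PM pQ.
have [C1 C10 NC1] := is_norm_le_normr hN.
have [C2 C20 NC2] := normr_le_is_norm hN.
(* The choice of [tau] makes the Markov term at most [p / 2]. *)
pose tau := (2 * C / p) `^ r^-1.
have tau0 : 0 < tau by rewrite powR_gt0// divr_gt0// mulr_gt0.
have tauE : tau `^ r = 2 * C / p.
  rewrite /tau -powRrM mulVf ?gt_eqF// powRr1// ltW// divr_gt0// mulr_gt0//.
pose c := p / (2 * M * tau ^+ d).
have c0 : 0 < c by rewrite divr_gt0// !mulr_gt0// exprn_gt0.
pose L := C2 * (`|q| + tau).
have L0 : 0 < L by rewrite mulr_gt0// ltr_wpDl.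
(* As [beta <= 1], also [beta ^ d <= c / 2]. *)
pose beta := Num.min 1 (c / 2).
have beta0 : 0 < beta by rewrite lt_min ltr01 divr_gt0.
pose sigma := C1 * (4 * L / beta).
have sigma0 : 0 < sigma by rewrite mulr_gt0// divr_gt0// mulr_gt0.
exists (c / 2), sigma, (Num.min 1 (beta / 4)); split=> //.
- by rewrite divr_gt0.
- by rewrite lt_min ltr01 divr_gt0.
move=> n eps s /andP[eps0]; rewrite le_min => /andP[eps1 epsb] epsn us s0 sC.
have epsd : 0 < eps ^+ d by rewrite exprn_gt0.
have epsr : 0 < eps `^ r by rewrite powR_gt0.
have nE : n%:R = (eps ^+ d)^-1 :> R.
  by apply: (@mulfI _ (eps ^+ d)); rewrite ?epsn ?divff ?gt_eqF.
pose t := tau * eps.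
have t0 : 0 < t by rewrite mulr_gt0.
pose T := [seq a <- s | N a < q + t].
have sizeT : c * n%:R <= (size T)%:R.
  have PMt a : (P (nball N a t) <= (M * t ^+ d)%:E)%E by exact: PM.
  have := le_trans pQ (prob_nball_le q t0 s0 PMt); rewrite -/T.
  have : ((t `^ - r)%:E * distortion N r P [set` s] <= (p / 2)%:E)%E.
    apply: (@le_trans _ _ ((t `^ - r)%:E * (C * eps `^ r)%:E)%E).
      by rewrite lee_wpmul2l// lee_fin powR_ge0.
    rewrite -EFinM lee_fin powRN /t powRM ?(ltW tau0) ?(ltW eps0)// tauE.
    rewrite le_eqVlt; apply/orP; left; apply/eqP; field.
    by rewrite !gt_eqF.
  move=> e1 e2; have := le_trans e2 (leeD2r _ e1).
  rewrite -EFinD lee_fin => pT.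
  have {}pT : p / 2 <= (size T)%:R * (M * t ^+ d) by lra.
  have td : t ^+ d = tau ^+ d * eps ^+ d by rewrite exprMn.
  have taud : 0 < tau ^+ d by rewrite exprn_gt0.
  rewrite -(ler_pM2r (mulr_gt0 M0 (exprn_gt0 d t0))) (le_trans _ pT)//.
  rewrite le_eqVlt; apply/orP; left; apply/eqP; rewrite td nE /c; field.
  by rewrite !gt_eqF.
pose close a := has (fun b => (b != a) && (N (a - b) <= sigma * eps)) s.
have sizeT' : (size [seq a <- T | ~~ close a])%:R <= c / 2 * n%:R.
  have be4 : 4 <= beta / eps by rewrite ler_pdivlMr// mulrC -ler_pdivlMr.
  have /andP[k1 k2] := truncn_itv (le_trans (ler0n R 4) be4).
  set k := Num.truncn _ in k1 k2.
  have k4 : (4 <= k)%N by rewrite -ltnS -(ltr_nat R) (le_lt_trans be4).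
  have k0 : (0 < k.-1)%N by case: k k4 {k1 k2} => [|[|]].
  have k'0 : 0 < k.-1%:R :> R by rewrite ltr0n.
  apply: (@le_trans _ _ (k ^ d)%:R); last first.
    rewrite natrX nE; apply: (@le_trans _ _ ((beta / eps) ^+ d)).
      by rewrite lerXn2r ?nnegrE// ?divr_ge0// ltW.
    rewrite expr_div_n ler_pM2r ?invr_gt0//.
    apply: (@le_trans _ _ beta); last by rewrite ge_min lexx orbT.
    by rewrite -[leRHS]expr1; apply: ler_wiXn2l; rewrite ?(ltW beta0)// ge_min lexx.
  rewrite ler_nat -(prednK (ltnW (ltnW (ltnW k4)))).
  apply: (@size_separated C1 L (sigma * eps)) => //.
  - by rewrite !filter_uniq.
  - move=> a; rewrite !mem_filter => /and3P[_ aq _].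
    rewrite (le_trans (NC2 _))// ler_pM2l// (le_trans (ltW aq))// lerD ?ler_norm//.
    by rewrite ler_piMr// ltW.
  - move=> a b; rewrite !mem_filter => /and3P[/hasPn na _ sa] /and3P[_ _ sb] ab.
    by have := na _ sb; rewrite eq_sym ab /= -ltNge.
  - have -> : sigma * eps = C1 * (2 * L * (2 * eps / beta)) by rewrite /sigma; ring.
    rewrite ler_pM2l// ler_pM2l; last by rewrite pmulr_rgt0.
    have kE : k%:R = k.-1%:R + 1 :> R by rewrite natr1 prednK// (leq_trans _ k4).
    have k2' : beta / eps <= 2 * k.-1%:R by move: k2; rewrite -natr1 kE; lra.
    have eb0 : 0 <= eps / beta by rewrite divr_ge0 ?ltW.
    rewrite -[leLHS]mul1r ler_pdivrMr//.
    have := ler_wpM2r eb0 k2'.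
    have -> : beta / eps * (eps / beta) = 1 by field; rewrite !gt_eqF.
    by move=> /le_trans; apply; rewrite le_eqVlt; apply/orP; left; apply/eqP; ring.
have sizeTE : (size T)%:R = (size [seq a <- T | close a])%:R +
    (size [seq a <- T | ~~ close a])%:R :> R.
  by rewrite -natrD -(count_predC close T) -!size_filter.
have le_size : (size [seq a <- T | close a])%:R <=
    (size (close_points (sigma * eps) s))%:R :> R.
  rewrite ler_nat /T -filter_predI !size_filter; apply: sub_count => a /=.
  by case/andP.
lra.
Qed.

(** * Removing and adding a point *)

(** For each [y], at most one deletion changes the distance from [y] to the
    codebook, and then it increases by at most [sigma]. *)
Lemma sum_dist_rem_le (sigma : R) s S y : 0 <= sigma -> uniq s -> uniq S ->
  {in S, forall a, exists b, [/\ a \in s, b \in s, b != a & N (a - b) <= sigma]} ->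
  \sum_(a <- S) dist_set N y [set` rem a s] `^ r <=
    (size S)%:R * dist_set N y [set` s] `^ r +
    2 `^ r * (dist_set N y [set` s] `^ r + sigma `^ r).
Proof.
move=> sigma0 us uS SP.
set D := dist_set N y [set` s]; pose u a := dist_set N y [set` rem a s].
have D0 : 0 <= D by exact: dist_set_ge0.
have rhs0 : 0 <= 2 `^ r * (D `^ r + sigma `^ r).
  by rewrite mulr_ge0 ?addr_ge0 ?powR_ge0.
have remP a b : b \in rem a s = (b != a) && (b \in s) by rewrite mem_rem_uniq.
have sum_const S' : {in S', forall a, u a <= D} ->
    \sum_(a <- S') u a `^ r <= (size S')%:R * D `^ r.
  elim: S' => [|a S' IH] S'u; first by rewrite big_nil mul0r.
  rewrite big_cons /= -natr1 mulrDl mul1r addrC lerD//.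
    by apply: IH => b bS; apply: S'u; rewrite in_cons bS orbT.
  rewrite ge0_ler_powR ?nnegrE ?(ltW r0)// ?dist_set_ge0//.
  by apply: S'u; rewrite mem_head.
have [/hasP[a aS aD]|/hasPn noD] := boolP (has (fun a => D < u a) S); last first.
  rewrite (le_trans (sum_const S _)) ?lerDl// => a /noD.
  by rewrite -leNgt.
rewrite (big_rem a)//= addrC.
have sz : (size (rem a S))%:R <= (size S)%:R :> R.
  by rewrite ler_nat size_rem// leq_pred.
have [b [sa sb ba ab]] := SP a aS.
rewrite lerD//.
  apply: (@le_trans _ _ ((size (rem a S))%:R * D `^ r)); last first.
    by rewrite ler_wpM2r// powR_ge0.
  apply: sum_const => a'; rewrite mem_rem_uniq// inE => /andP[a'a a'S].
  rewrite leNgt; apply/negP => a'D.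
  have [||c /= sc yc] := @dist_set_lt _ _ N y [set` s] (Num.min (u a) (u a')).
  - by exists a.
  - by rewrite lt_min; apply/andP; split; [exact: aD|exact: a'D].
  move: yc; rewrite lt_min => /andP[yca yca'].
  have : (c != a) || (c != a').
    by have [->|//] := eqVneq c a; rewrite eq_sym.
  move=> /orP[ca|ca].
  + have : [set` rem a s] c by rewrite /= remP ca.
    by move=> /(dist_set_le hN y); rewrite -/(u a) leNgt yca.
  + have : [set` rem a' s] c by rewrite /= remP ca.
    by move=> /(dist_set_le hN y); rewrite -/(u a') leNgt yca'.
have uaD : u a <= D + sigma.
  rewrite -lerBlDr; apply: le_dist_set => //; first by exists a.
  move=> c /= sc; rewrite lerBlDr; have [->|ca] := eqVneq c a.
    rewrite (le_trans (@dist_set_le _ _ _ hN y [set` rem a s] b _))//.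
      by rewrite /= remP ba.
    by rewrite (le_trans (is_norm_trans hN a _ _))// lerD2l.
  rewrite (le_trans (@dist_set_le _ _ _ hN y [set` rem a s] c _)) ?lerDl//.
  by rewrite /= remP ca.
apply: (@le_trans _ _ ((2 * Num.max D sigma) `^ r)).
  rewrite ge0_ler_powR ?nnegrE ?(ltW r0) ?dist_set_ge0//.
    by rewrite mulr_ge0// le_max D0.
  rewrite (le_trans uaD)// mulr_natl mulr2n lerD// le_max lexx ?orbT//.
rewrite powRM// ?le_max ?D0// ler_wpM2l ?powR_ge0//.
by have [_|_] := leP D sigma; rewrite ?lerDl ?lerDr powR_ge0.
Qed.

(** Adding to [A] a point [x] at distance at least [t] improves the distance to
    the codebook uniformly on the ball of radius [t / 4] about [x]. *)
Lemma distortion_add_le (t : R) A x : 0 < t -> A !=set0 ->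
  t <= dist_set N x A ->
  (distortion N r P (x |` A) +
   ((((3 / 4) `^ r - (1 / 4) `^ r) * t `^ r)%:E * P (nball N x (t / 4))) <=
   distortion N r P A)%E.
Proof.
move=> t0 A0 tx; set k := _ - _.
have k0 : 0 <= k * t `^ r.
  rewrite mulr_ge0 ?powR_ge0// subr_ge0 ge0_ler_powR ?nnegrE ?(ltW r0)//; lra.
have mB := measurable_nball hN x (t / 4).
rewrite -(integral_cst P mB) /distortion.
rewrite [X in (_ + X)%E]integral_mkcond -ge0_integralD//; last 4 first.
- by move=> y _; rewrite lee_fin powR_ge0.
- exact: measurable_dist_powR.
- by move=> y _; rewrite patchE; case: ifP => //; rewrite lee_fin.
- by apply/(measurable_restrictT _ mB); exact: measurable_cst.
apply: ge0_le_integral => //.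
- move=> y _; rewrite adde_ge0 ?lee_fin ?powR_ge0//.
  by rewrite patchE; case: ifP => //; rewrite lee_fin.
- apply: emeasurable_funD; first exact: measurable_dist_powR.
  by apply/(measurable_restrictT _ mB); exact: measurable_cst.
- exact: measurable_dist_powR.
move=> y _; rewrite patchE; case: ifPn; last first.
  move=> _; rewrite adde0 lee_fin ge0_ler_powR ?nnegrE ?(ltW r0) ?dist_set_ge0//.
  by apply: dist_set_subset => //; exact: subsetUr.
rewrite inE /nball/= => xy; rewrite -EFinD lee_fin.
have y1 : dist_set N y (x |` A) <= t / 4.
  by rewrite (le_trans (dist_set_le hN y (or_introl (erefl x))))// ltW.
have y3 : 3 / 4 * t <= dist_set N y A.
  have := dist_set_lip hN x y A; rewrite (is_normC hN); lra.
apply: (@le_trans _ _ ((3 / 4 * t) `^ r)); last first.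
  rewrite ge0_ler_powR ?nnegrE ?(ltW r0) ?dist_set_ge0// mulr_ge0 ?(ltW t0)//.
apply: (@le_trans _ _ ((1 / 4 * t) `^ r + k * t `^ r)).
  rewrite lerD2r ge0_ler_powR ?nnegrE ?(ltW r0) ?dist_set_ge0//; lra.
have t0' := ltW t0.
rewrite (@powRM _ (1 / 4) t) ?divr_ge0// (@powRM _ (3 / 4) t) ?divr_ge0//.
by rewrite /k mulrBl [leLHS]addrC subrK.
Qed.

(** Deleting any [a] from [S] and adding [x] cannot beat the optimal codebook.
    Summing over [a], the gains at [x] add up, while by [sum_dist_rem_le] the
    total loss stays bounded independently of the size of [S]. *)
Lemma optimal_swap_le n A (sigma t : R) s S x : optimal_codebook N r P n A ->
  A = [set` s] -> uniq s -> (size s <= n)%N -> 0 <= sigma -> uniq S ->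
  {in S, forall a, exists b, [/\ a \in s, b \in s, b != a & N (a - b) <= sigma]} ->
  (distortion N r P A < +oo)%E -> 0 < t -> t <= dist_set N x A ->
  ((size S)%:R%:E * ((((3 / 4) `^ r - (1 / 4) `^ r) * t `^ r)%:E *
      P (nball N x (t / 4))) <=
   (2 `^ r)%:E * (distortion N r P A + (sigma `^ r)%:E))%E.
Proof.
move=> [_ AE] sA us sn sigma0 uS SP Afin t0 tx.
set G := (_ * P _)%E; set e := distortion N r P A.
have e0 : (0 <= e)%E by apply: integral_ge0 => y _; rewrite lee_fin powR_ge0.
have efin : e \is a fin_num by rewrite ge0_fin_numE.
have swap a : a \in S -> (e + G <= distortion N r P [set` rem a s])%E.
  move=> aS; have [b [sa sb ba ab]] := SP a aS.
  have rem0 : [set` rem a s] !=set0 by exists b; rewrite /= mem_rem_uniq// inE ba.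
  have tx' : t <= dist_set N x [set` rem a s].
    rewrite (le_trans tx)// sA; apply: dist_set_subset => //.
    by move=> c /= /mem_rem.
  apply: le_trans (distortion_add_le t0 rem0 tx'); apply: leeD2r; rewrite /e AE.
  apply: ereal_inf_lbound; exists (x |` [set` rem a s]) => //; split.
    by exists x; left.
  apply/card_le_II_seqP; exists (undup (x :: rem a s)); split.
  - exact: undup_uniq.
  - rewrite (leq_trans (size_undup _))//= size_rem// prednK//.
    by case: (s) sa.
  - have uE y : (y \in undup (x :: rem a s)) = (y == x) || (y \in rem a s).
      by rewrite mem_undup inE.
    apply/seteqP; split=> y; [case=> [->|ya]|move=> ya].
    + by have := uE x; rewrite eqxx.
    + by have := uE y; rewrite [_ \in rem _ _]ya orbT.
    + have : y \in undup (x :: rem a s) by [].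
      by rewrite uE => /orP[/eqP ->|]; [left|right].
have Slow : ((size S)%:R%:E * (e + G) <=
    \sum_(a <- S) distortion N r P [set` rem a s])%E.
  exact: sume_ge_const.
have Sup : (\sum_(a <- S) distortion N r P [set` rem a s] <=
    (size S)%:R%:E * e + (2 `^ r)%:E * (e + (sigma `^ r)%:E))%E.
  rewrite /distortion -ge0_integral_sum//; last 2 first.
  - by move=> a; exact: measurable_dist_powR.
  - by move=> a y _; rewrite lee_fin powR_ge0.
  pose D y := dist_set N y A.
  have mD : measurable_fun setT (fun y => (D y `^ r)%:E).
    exact: measurable_dist_powR.
  have D0 y : [set: 'rV[R]_d] y -> (0 <= (D y `^ r)%:E)%E.
    by rewrite lee_fin powR_ge0.
  apply: (@le_trans _ _ (\int[P]_y ((size S)%:R%:E * (D y `^ r)%:E +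
      (2 `^ r)%:E * ((D y `^ r)%:E + (sigma `^ r)%:E)))%E).
    apply: ge0_le_integral => //.
    - by move=> y _; apply: sume_ge0 => a _; rewrite lee_fin powR_ge0.
    - by apply: emeasurable_sum => a; exact: measurable_dist_powR.
    - apply: emeasurable_funD; first exact: measurable_funeM.
      by apply: measurable_funeM; exact: emeasurable_funD.
    move=> y _; rewrite sumEFin -!(EFinM, EFinD) lee_fin /D sA.
    exact: sum_dist_rem_le.
  rewrite ge0_integralD//; last 4 first.
  - by move=> y _; rewrite mule_ge0// lee_fin ?powR_ge0.
  - exact: measurable_funeM.
  - by move=> y _; rewrite mule_ge0// ?adde_ge0 ?lee_fin ?powR_ge0.
  - by apply: measurable_funeM; exact: emeasurable_funD.
  rewrite ge0_integralZl ?lee_fin// ge0_integralZl ?lee_fin ?powR_ge0//; last 2 first.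
  - exact: emeasurable_funD.
  - by move=> y _; rewrite adde_ge0 ?lee_fin ?powR_ge0.
  have sE : (\int[P]_y (sigma `^ r)%:E = (sigma `^ r)%:E)%E.
    apply: etrans (integral_cst P measurableT _) _.
    by rewrite [X in (_ * X)%E](probability_setT P) mule1.
  by rewrite ge0_integralD ?sE// => y _; rewrite lee_fin powR_ge0.
have := le_trans Slow Sup.
have G0 : (0 <= G)%E.
  rewrite mule_ge0// lee_fin mulr_ge0 ?powR_ge0// subr_ge0.
  by rewrite ge0_ler_powR ?nnegrE ?(ltW r0)//; lra.
rewrite ge0_muleDr// leeD2lE// fin_numM//.
Qed.

End codebook.

(** * The local bound on the distance to an optimal codebook *)

Lemma powR_root_le {R : realType} (d : nat) (r K t eps h : R) :
  0 < r -> 0 < K -> 0 < t -> 0 < eps -> 0 < h ->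
  t `^ r * t ^+ d * h <= K * (eps `^ r * eps ^+ d) ->
  t <= K `^ (r + d%:R)^-1 * eps * h `^ (- (r + d%:R)^-1).
Proof.
move=> r0 K0 t0 eps0 h0; set q := r + d%:R.
have q0 : 0 < q by rewrite ltr_wpDr.
have powq (u : R) : 0 < u -> u `^ r * u ^+ d = u `^ q.
  by move=> u0; rewrite -powR_mulrn ?(ltW u0)// -powRD// (gt_eqF u0) implybT.
have root (u : R) : 0 < u -> (u `^ q) `^ q^-1 = u.
  by move=> u0; rewrite -powRrM mulfV ?gt_eqF// powRr1// ltW.
rewrite !powq// -ler_pdivlMr// => tK.
have hV : h `^ (- q^-1) = (h^-1) `^ q^-1.
  by rewrite -(powR_inv1 (ltW h0)) -powRrM mulN1r.
rewrite hV -(root t)// -{1}(root eps)// -powRM ?powR_ge0// ?(ltW K0)//.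
rewrite -powRM ?mulr_ge0 ?powR_ge0 ?invr_ge0 ?(ltW K0) ?(ltW h0)//.
rewrite ge0_ler_powR ?nnegrE ?invr_ge0 ?(ltW q0) ?powR_ge0//.
by rewrite !mulr_ge0 ?powR_ge0 ?invr_ge0 ?(ltW K0) ?(ltW h0).
Qed.

Theorem proposition4p2 (R : realType) (d : nat) (hd : (0 < d)%N)
  (N : 'rV[R]_d -> R) (hN : is_norm N)
  (r : R) (hr : 0 < r)
  (P : probability 'rV[R]_d R)
  (hmoment : exists2 delta : R, 0 < delta &
     (\int[P]_x (N x `^ (r + delta))%:E < +oo)%E)
  (alpha : nat -> set 'rV[R]_d)
  (halpha : forall n, (0 < n)%N -> optimal_codebook N r P n (alpha n))
  (rho : R) (hrho : 0 < rho)
  (h : 'rV[R]_d -> R) (hP : PSTP N P h rho)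
  (hbounded : exists M : R, forall x, cnball N 0 rho x -> h x <= M) :
  exists2 c21 : R, 0 < c21 &
    forall K : set 'rV[R]_d, compact K ->
      exists2 nK : nat, (0 < nK)%N &
        forall n, (nK <= n)%N -> forall x, K x ->
          dist_set N x (alpha n) <=
          c21 * n%:R `^ (- d%:R^-1) * h x `^ (- (r + d%:R)^-1).
Proof.
have dP := PSTP_density hP.
have h_gt0 x : 0 < h x.
  by have [c c0 ch] := PSTP_compact hP (N x); rewrite (lt_le_trans c0)// ch.
have [M M0 hM] := PSTP_bounded hN hP hbounded.
have [c [s1 [c0 s10 PB]]] := PSTP_nball_ge hN hP hbounded.
have [Cl Cl0 lebB] := lebesgue_nball_le hN.
have PM (x : 'rV[R]_d) (t : R) : 0 < t -> (P (nball N x t) <= (M * Cl * t ^+ d)%:E)%E.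
  move=> t0; apply: le_trans (density_le dP (measurable_nball hN x t) hM) _.
  by rewrite -mulrA [leRHS]EFinM lee_wpmul2l ?lee_fin ?(ltW M0)// lebB.
have PQ : ((c * h 0 * (s1 / 2) ^+ d)%:E <= P (nball N 0 (s1 / 2)))%E.
  by apply: PB; rewrite divr_gt0//= ltr_pdivrMr// ltr_pMr// ltr1n.
have p0 : 0 < c * h 0 * (s1 / 2) ^+ d.
  by rewrite !mulr_gt0// exprn_gt0// divr_gt0.
have [delta delta0 moment] := hmoment.
have [C C0 eC] := optimal_distortion_le hN hr delta0 moment.
have [c1 [sigma [eps0 [c10 sigma0 eps00 closeP]]]] :=
  size_close_points hN hr hd (mulr_gt0 M0 Cl0) p0 C0 PM PQ.
pose k : R := (3 / 4) `^ r - (1 / 4) `^ r.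
have k0 : 0 < k.
  by rewrite subr_gt0 gt0_ltr_powR ?nnegrE//; lra.
pose A := c1 * k * c / 4 ^+ d.
have A0 : 0 < A by rewrite divr_gt0 ?mulr_gt0// exprn_gt0.
pose B := 2 `^ r * (C + sigma `^ r).
have B0 : 0 < B by rewrite mulr_gt0 ?powR_gt0// ltr_wpDr// powR_ge0.
pose c21 := (B / A) `^ (r + d%:R)^-1.
have c210 : 0 < c21 by rewrite powR_gt0// divr_gt0.
exists c21 => // K cK.
have [TK hTK] : exists T : R, forall x, K x -> N x <= T.
  have [b [_ Kb]] := compact_bounded cK.
  have [C1 C10 NC1] := is_norm_le_normr hN.
  exists (C1 * (b + 1)) => x Kx; rewrite (le_trans (NC1 x))// ler_pM2l//.
  by apply: Kb => //; rewrite ltrDl.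
have [hK hK0 hKP] := PSTP_compact hP TK.
pose E := c21 * hK `^ (- (r + d%:R)^-1).
have E0 : 0 < E by rewrite mulr_gt0// powR_gt0.
pose eta := Num.min (Num.min eps0 (1 / 2)) (s1 / (2 * E)).
have eta0 : 0 < eta by rewrite !lt_min eps00 divr_gt0//= divr_gt0// mulr_gt0.
exists (Num.truncn (eta ^- d)).+1 => // n nK x Kx.
have n0 : (0 < n)%N by rewrite (leq_trans _ nK).
set eps := n%:R `^ _.
have n0' : 0 < n%:R :> R by rewrite ltr0n.
have eps_gt0 : 0 < eps by rewrite powR_gt0.
have epsn : eps ^+ d * n%:R = 1.
  rewrite -powR_mulrn ?(ltW eps_gt0)// -powRrM mulNr mulVf ?pnatr_eq0 -?lt0n//.
  by rewrite powR_inv1 ?(ltW n0')// mulVf ?gt_eqF.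
have eps_eta : eps <= eta.
  rewrite -(ler_pXn2r hd) ?nnegrE ?(ltW eta0) ?(ltW eps_gt0)//.
  have etad : 0 < eta ^+ d by rewrite exprn_gt0.
  have le_n : eta ^- d <= n%:R.
    by rewrite (le_trans (ltW (truncnS_gt _)))// ler_nat.
  by rewrite -(ler_pM2r n0') epsn -ler_pdivrMl// mulr1.
have : [/\ eps <= eps0, 2 * eps <= 1 & E * eps < s1].
  move: eps_eta; rewrite !le_min => /andP[/andP[-> e2] eE]; split=> //; first lra.
  have : E * eps <= s1 / 2.
    by rewrite -ler_pdivlMl// (le_trans eE)// invfM mulrA mulrC.
  lra.
move=> [ee0 e2 eE].
(* This also disposes of an empty codebook, whose distance function is 0. *)
have [D0|D0] := leP (dist_set N x (alpha n)) 0.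
  by rewrite (le_trans D0)// !mulr_ge0 ?powR_ge0// ltW.
have opt := halpha n n0.
have [s [us sn sA]] : exists s, [/\ uniq s, (size s <= n)%N & alpha n = [set` s]].
  by apply/card_le_II_seqP; case: opt.
have s_neq0 : s != [::].
  apply/eqP => s0; move: D0; rewrite sA s0 (_ : [set` [::]] = set0); last first.
    by apply/seteqP; split.
  by rewrite /dist_set image_set0 inf0 ltxx.
have en := eC n eps _ eps_gt0 e2 epsn opt.
pose S := close_points N (sigma * eps) s.
have sizeS : c1 * n%:R <= (size S)%:R.
  have eps_range : 0 < eps <= eps0 by rewrite eps_gt0.
  by apply: (closeP n eps s eps_range epsn us s_neq0); rewrite -sA.
(* The distance is truncated at [s1], where the mass bound [PB] is available;
   the bound obtained for [t] then shows that the minimum is not [s1]. *)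
pose t := Num.min (dist_set N x (alpha n)) s1.
have t0 : 0 < t by rewrite lt_min D0.
have tD : t <= dist_set N x (alpha n) by rewrite ge_min lexx.
have ts1 : t <= s1 by rewrite ge_min lexx orbT.
have tle : t <= c21 * eps * h x `^ (- (r + d%:R)^-1).
  apply: powR_root_le => //; first by rewrite divr_gt0.
  have SP : {in S, forall a, exists b,
      [/\ a \in s, b \in s, b != a & N (a - b) <= sigma * eps]}.
    move=> a; rewrite mem_filter => /andP[/hasP[b sb /andP[ba ab]] sa].
    by exists b.
  have se0 : 0 <= sigma * eps by rewrite mulr_ge0// ltW.
  have efin : (distortion N r P (alpha n) < +oo)%E.
    by rewrite (le_lt_trans en)// ltry.
  have := optimal_swap_le hN hr opt sA us sn se0 (filter_uniq _ us) SP efin t0 tD.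
  rewrite -/S -/k => swap.
  have Pt : ((c * h x * (t / 4) ^+ d)%:E <= P (nball N x (t / 4)))%E.
    apply: PB; rewrite divr_gt0//=; lra.
  have kt0 : 0 <= k * t `^ r by rewrite mulr_ge0 ?powR_ge0// ltW.
  have lower : ((c1 * n%:R * (k * t `^ r * (c * h x * (t / 4) ^+ d)))%:E <=
      (size S)%:R%:E * ((k * t `^ r)%:E * P (nball N x (t / 4))))%E.
    apply: (@le_trans _ _ ((size S)%:R%:E * ((k * t `^ r)%:E *
        (c * h x * (t / 4) ^+ d)%:E))%E).
      rewrite -!EFinM lee_fin; apply: ler_wpM2r sizeS; apply: mulr_ge0 => //.
      by rewrite !mulr_ge0 ?exprn_ge0 ?divr_ge0 ?(ltW c0) ?(ltW (h_gt0 x)) ?(ltW t0).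
    by rewrite lee_wpmul2l ?lee_fin// lee_wpmul2l ?lee_fin.
  have upper : ((2 `^ r)%:E * (distortion N r P (alpha n) + ((sigma * eps) `^ r)%:E) <=
      (B * eps `^ r)%:E)%E.
    apply: (@le_trans _ _ ((2 `^ r)%:E * ((C * eps `^ r)%:E + ((sigma * eps) `^ r)%:E))%E).
      by rewrite lee_wpmul2l ?lee_fin ?powR_ge0// leeD2r.
    rewrite powRM ?(ltW sigma0) ?(ltW eps_gt0)// -EFinD -EFinM lee_fin /B.
    by rewrite -mulrDl mulrA.
  have := le_trans lower (le_trans swap upper); rewrite lee_fin expr_div_n => le_tB.
  have epsd : 0 < eps ^+ d by rewrite exprn_gt0.
  have fourd : (4 : R) ^+ d != 0 by rewrite expf_neq0// gt_eqF.
  rewrite [leRHS]mulrAC ler_pdivlMr// -(ler_pM2r n0').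
  have -> : t `^ r * t ^+ d * h x * A * n%:R =
      c1 * n%:R * (k * t `^ r * (c * h x * (t ^+ d / 4 ^+ d))).
    by rewrite /A; move: (t `^ r) (t ^+ d) (4 ^+ d) fourd => u v w w0; field.
  by rewrite [leRHS](_ : _ = B * eps `^ r)// -!mulrA epsn mulr1.
have [Ds1|s1D] := leP (dist_set N x (alpha n)) s1.
  by move: tle; rewrite /t min_l.
have : t = s1 by rewrite /t min_r// ltW.
move=> tE; move: tle; rewrite tE leNgt => /negP; case.
apply: le_lt_trans eE; rewrite /E mulrAC ler_pM2r// ler_pM2l//.
rewrite !powRN lef_pV2 ?posrE ?powR_gt0// ge0_ler_powR ?nnegrE ?(ltW hK0) ?(ltW (h_gt0 x))//.
  by rewrite invr_ge0 addr_ge0// ltW.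
by apply: hKP; exact: hTK.
Qed.
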